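(* There is an absolute constant $C>0$ such that $f(5,n)\le C n^{-7/3}$ for infinitely many positive integers $n$.
   Context: For positive integers $k,n$, $f(k,n)$ denotes the smallest non-zero value of $|z_1+\cdots+z_k|$, where $z_1,\dots,z_k$ range over complex $n$th roots of unity (repetitions allowed), i.e. $f(k,n)=\min\{|z_1+\cdots+z_k| : z_j^n=1 \text{ for all } j,\ z_1+\cdots+z_k\neq 0\}$. *)

(* Defs.v *)
From HB Require Import structures.
From mathcomp Require Import all_boot all_order all_algebra.
From mathcomp Require Import all_classical all_reals all_analysis.
From mathcomp Require Import complex.
Import Order.TTheory GRing.Theory Num.Theory.
Import numFieldNormedType.Exports.
Local Open Scope classical_set_scope.
Local Open Scope ring_scope.

(* [normc] is the real-valued modulus of a complex number. *)
Definition nonzero_root_sum_moduli (R : realType) (k n : nat) : set R :=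
  [set x | exists z : 'I_k -> R[i],
     [/\ forall j, z j ^+ n = 1,
         \sum_(j < k) z j != 0 &
         x = ComplexField.Normc.normc (\sum_(j < k) z j)]].

(* For positive k and n this infimum is a minimum, see [root_sum_min_attained]
   and [root_sum_min_le]. *)
Definition root_sum_min (R : realType) (k n : nat) : R :=
  inf (nonzero_root_sum_moduli R k n).

Lemma normc_ge0 (R : realType) (z : R[i]) : 0 <= ComplexField.Normc.normc z.
Proof. by case: z => a b; exact: sqrtr_ge0. Qed.

Lemma root_sum_min_le (R : realType) (k n : nat) (x : R) :
  nonzero_root_sum_moduli R k n x -> root_sum_min R k n <= x.
Proof.
by apply: ge_inf; exists 0 => _ [z [_ _ ->]]; exact: normc_ge0.
Qed.

Lemma root_sum_min_attained (R : realType) (k n : nat) :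
  (0 < k)%N -> (0 < n)%N ->
  nonzero_root_sum_moduli R k n (root_sum_min R k n).
Proof.
move=> k0 n0.
have [s Es] := closed_field_poly_normal ('X^n - 1 : {poly R[i]}).
have rootP (z : R[i]) : (z \in s) = (z ^+ n == 1).
  rewrite -root_prod_XsubC -[RHS]subr_eq0.
  have := Es; rewrite lead_coefXnsubC // scale1r => <-.
  by rewrite rootE !hornerE.
have s1 : 1 \in s by rewrite rootP expr1n.
pose T := {ffun 'I_k -> seq_sub s}.
pose S (t : T) : R[i] := \sum_(j < k) ssval (t j).
pose t0 : T := [ffun=> SeqSub s1].
have St0 : S t0 != 0.
  rewrite /S (eq_bigr (fun=> 1)) => [|j _]; last by rewrite ffunE.
  by rewrite sumr_const card_ord pnatr_eq0 -lt0n.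
have [t St tmin] :=
  @arg_minP _ R T t0 (fun t => S t != 0)
    (fun t => ComplexField.Normc.normc (S t)) St0.
have Vt : nonzero_root_sum_moduli R k n (ComplexField.Normc.normc (S t)).
  exists (fun j => ssval (t j)); split=> // j.
  by apply/eqP; rewrite -rootP; exact: ssvalP.
suff -> : root_sum_min R k n = ComplexField.Normc.normc (S t) by [].
apply/eqP; rewrite eq_le root_sum_min_le //=.
apply: lb_le_inf; first by exists (ComplexField.Normc.normc (S t)).
move=> _ [z [z1 z0 ->]].
have zs j : z j \in s by rewrite rootP z1.
pose u : T := [ffun j => SeqSub (zs j)].
have Su : S u = \sum_(j < k) z j by apply: eq_bigr => j _; rewrite ffunE.
by rewrite -Su tmin // Su.
Qed.

(* Main.v *)
(** Move the vertices of the regular pentagon by [a t] and [- b t] (and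
    symmetrically), where [t = 2 pi / n] and [5] divides [n]; these remain [n]th
    roots of unity for integers [a] and [b], and their sum [S (t)] is real.  The
    linear term of [S] is a multiple of [a - b / phi] with [phi] the golden ratio,
    so it is of order [1 / a] when [a, b] are consecutive Fibonacci numbers, and
    for the right parity its sign is opposite to that of the quadratic term, of
    order [a^2].  Hence [S] changes sign for some [t] of order [a^-3], i.e. for
    [n] of order [a^3].  There [S'] is [O(1 / a)], while passing from [n] to
    [n + 5] changes [t] by [O(a^-6)]: the last positive value of [S] before the
    sign change is [O(a^-7)], which is [O(n^(-7/3))]. *)
Require Import Defs.
From mathcomp Require Import all_boot all_order all_algebra.
From mathcomp Require Import all_classical all_reals all_analysis.
From mathcomp Require Import complex.
From mathcomp Require Import ring lra zify.
Import Order.TTheory GRing.Theory Num.Theory.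
Import numFieldNormedType.Exports.
Local Open Scope classical_set_scope.
Local Open Scope ring_scope.

(** * Taylor bounds for sine and cosine on the nonnegative half-line *)

(** By the mean value theorem. Starting from [cos <= 1], this integrates each Taylor bound below
    into the next one. *)
Lemma ge0_of_derive (R : realType) (f df : R -> R) :
  (forall x : R, is_derive x 1 f (df x)) -> f 0 = 0 ->
  (forall x, 0 <= x -> 0 <= df x) -> forall x, 0 <= x -> 0 <= f x.
Proof.
move=> fdf f0 df0 x x0.
have fc : {within `[0, x], continuous f}.
  apply: continuous_subspaceT => y; apply: differentiable_continuous.
  by apply/derivable1_diffP; exact: ex_derive.
have [c] := MVT_segment x0 (fun y _ => fdf y) fc.
rewrite in_itv/= => /andP[c0 _]; rewrite f0 !subr0 => ->.
by rewrite mulr_ge0// df0.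
Qed.

Lemma sin_le_id (R : realType) (x : R) : 0 <= x -> sin x <= x.
Proof.
move=> x0; rewrite -subr_ge0.
apply: (@ge0_of_derive R (fun y => y - sin y) (fun y => 1 - cos y)) => //.
by rewrite sin0 subrr.
Qed.

Lemma cos_ge_taylor2 (R : realType) (x : R) : 0 <= x -> 1 - x ^+ 2 / 2 <= cos x.
Proof.
move=> x0; rewrite -subr_ge0.
apply: (@ge0_of_derive R (fun y => cos y - (1 - y ^+ 2 / 2))
  (fun y => y - sin y)) => //.
- move=> y; apply: is_derive_eq; rewrite /GRing.scale/=; lra.
- by rewrite cos0; lra.
- by move=> y y0; rewrite subr_ge0 sin_le_id.
Qed.

Lemma sin_ge_taylor3 (R : realType) (x : R) : 0 <= x -> x - x ^+ 3 / 6 <= sin x.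
Proof.
move=> x0; rewrite -subr_ge0.
apply: (@ge0_of_derive R (fun y => sin y - (y - y ^+ 3 / 6))
  (fun y => cos y - (1 - y ^+ 2 / 2))) => //.
- move=> y; apply: is_derive_eq; rewrite /GRing.scale/=; lra.
- by rewrite sin0; lra.
- by move=> y y0; rewrite subr_ge0 cos_ge_taylor2.
Qed.

Lemma cos_le_taylor4 (R : realType) (x : R) : 0 <= x ->
  cos x <= 1 - x ^+ 2 / 2 + x ^+ 4 / 24.
Proof.
move=> x0; rewrite -subr_ge0.
apply: (@ge0_of_derive R (fun y => 1 - y ^+ 2 / 2 + y ^+ 4 / 24 - cos y)
  (fun y => sin y - (y - y ^+ 3 / 6))) => //.
- move=> y; apply: is_derive_eq; rewrite /GRing.scale/=; lra.
- by rewrite cos0; lra.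
- by move=> y y0; rewrite subr_ge0 sin_ge_taylor3.
Qed.

(** * Real sums of five roots of unity *)

Lemma cis_expr (R : realType) (x : R) n :
  (cos x +i* sin x)%C ^+ n = (cos (x *+ n) +i* sin (x *+ n))%C.
Proof.
elim: n => [|n IHn]; first by rewrite expr0 mulr0n cos0 sin0.
rewrite exprS IHn mulrS cosD sinD.
by apply/eqP; rewrite eq_complex/=; apply/andP; split; apply/eqP; ring.
Qed.

Lemma cis_unity_root (R : realType) (x : R) (n k : nat) :
  x * n%:R = 2 * pi * k%:R -> (cos x +i* sin x)%C ^+ n = 1.
Proof.
move=> xn; rewrite cis_expr.
have -> : x *+ n = 0 + pi *+ 2 *+ k.
  by rewrite add0r -[LHS]mulr_natr xn -[RHS]mulr_natr mulr2n; ring.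
by rewrite (periodicn (@cosD2pi R)) (periodicn (@sinD2pi R)) cos0 sin0.
Qed.

Lemma cis_unity_rootN (R : realType) (x : R) (n k : nat) :
  x * n%:R = 2 * pi * k%:R -> (cos x +i* - sin x)%C ^+ n = 1.
Proof.
by move=> /cis_unity_root x1; rewrite -[RHS]conjc1 -x1 rmorphXn.
Qed.

(** The roots are 1 and two conjugate pairs, so their sum is real and, being positive, equals its
    modulus. *)
Lemma root_sum_min5_le (R : realType) (n j k : nat) (x y : R) :
  x * n%:R = 2 * pi * j%:R -> y * n%:R = 2 * pi * k%:R ->
  0 < 1 + 2 * cos x + 2 * cos y ->
  root_sum_min R 5 n <= 1 + 2 * cos x + 2 * cos y.
Proof.
move=> xn yn s0; apply: root_sum_min_le.
pose z := [:: 1; (cos x +i* sin x)%C; (cos x +i* - sin x)%C;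
                 (cos y +i* sin y)%C; (cos y +i* - sin y)%C].
have Sz : \sum_(i < 5) z`_i = (1 + 2 * cos x + 2 * cos y)%:C%C.
  rewrite !big_ord_recr big_ord0/=.
  by apply/eqP; rewrite eq_complex/=; apply/andP; split; apply/eqP; ring.
exists (fun i => z`_i); rewrite Sz; split.
- case=> -[|[|[|[|[|//]]]]] _ /=; rewrite ?expr1n//;
    by [exact: cis_unity_root xn | exact: cis_unity_rootN xn
      | exact: cis_unity_root yn | exact: cis_unity_rootN yn].
- by rewrite eq_complex/= negb_and gt_eqF.
- by rewrite /= expr0n/= addr0 sqrtr_sqr gtr0_norm.
Qed.

(** * The regular pentagon and the golden ratio *)

Lemma sin_2pi5_gt0 (R : realType) : 0 < sin (2 * pi / 5 : R).
Proof. by have p := pi_gt0 R; apply: sin_gt0_pi; apply/andP; split; lra. Qed.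

(** For the angle x = 2 pi / 5, 3x = 2 pi - 2x gives sin 3x = - sin 2x; dividing by sin x leaves 4
    c^2 - 1 = - 2 c. *)
Lemma cos_2pi5 (R : realType) (c := cos (2 * pi / 5 : R)) :
  0 < c /\ 4 * c ^+ 2 + 2 * c = 1.
Proof.
have p := pi_gt0 R.
split; first by apply: cos_gt0_pihalf; apply/andP; split; lra.
have s0 := sin_2pi5_gt0 R.
have : sin (2 * pi / 5 + (2 * pi / 5) *+ 2 : R) = - sin ((2 * pi / 5) *+ 2).
  have -> : 2 * pi / 5 + (2 * pi / 5) *+ 2 = - ((2 * pi / 5) *+ 2) + pi *+ 2 :> R.
    by lra.
  by rewrite sinD2pi sinN.
rewrite sinD sin_mulr2n cos_mulr2n -/c => E.
apply: (mulfI (lt0r_neq0 s0)); rewrite mulr1.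
have := sin2cos2 (2 * pi / 5 : R); rewrite -/c => E2.
move: E; rewrite !mulr2n; nra.
Qed.

Definition pentagon_sum (R : realType) (a b t : R) : R :=
  1 + 2 * cos (2 * pi / 5 + a * t) + 2 * cos (4 * pi / 5 - b * t).

(* [q = 2 cos (2 pi / 5)] is the inverse of the golden ratio. *)
Lemma pentagon_sumE (R : realType) : exists s q : R,
  [/\ 9 / 10 <= s <= 1, 3 / 5 <= q <= 31 / 50, q ^+ 2 + q = 1 &
    forall a b t, pentagon_sum R a b t =
      1 + q * cos (a * t) - 2 * s * sin (a * t)
        - (1 + q) * cos (b * t) + 2 * q * s * sin (b * t)].
Proof.
have [c0 c1] := cos_2pi5 R; have s0 := sin_2pi5_gt0 R.
have sc := sin2cos2 (2 * pi / 5 : R).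
exists (sin (2 * pi / 5)), (2 * cos (2 * pi / 5)).
rewrite /pentagon_sum.
have -> : 4 * pi / 5 = (2 * pi / 5) *+ 2 :> R by lra.
set c := cos _ in c0 c1 sc *; set s := sin _ in s0 sc *.
split.
- by apply/andP; split; nra.
- by apply/andP; split; nra.
- by lra.
- move=> a b t; rewrite cosD cosB sin_mulr2n cos_mulr2n -/c -/s.
  (* This turns cos (4 pi / 5) = 2 c^2 - 1 into - (1 + q) / 2. *)
  have -> : c ^+ 2 = (1 - 2 * c) / 4 by lra.
  by rewrite !mulr2n; field.
Qed.

(* The norm equation makes [b / a] a convergent of the golden ratio, from below:
   this is the sign that makes [S] decrease at [0]. *)
Definition golden_pair (R : realType) (a b : R) : Prop :=
  [/\ 10 <= a, 3 * a <= 2 * b, b <= 2 * a & b ^+ 2 - a * b - a ^+ 2 = -1].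

(** The conjugate of q is - 1 - q, so a - b q times its conjugate a + b (1 + q) is the norm, here 1.
    The second factor lies between 17/5 a and 17/4 a, which places the first between multiples of 1
    / a. *)
Lemma golden_pair_inv (R : realType) (a b q : R) :
  golden_pair R a b -> 3 / 5 <= q <= 31 / 50 -> q ^+ 2 + q = 1 ->
  [/\ a * a^-1 = 1, 0 < a^-1, a^-1 <= 1 / 10 &
      23 / 100 * a^-1 <= a - b * q <= 3 / 10 * a^-1].
Proof.
move=> [a10 lab uab nab] /andP[q0 q1] q2.
have ad : a * a^-1 = 1 by rewrite divff// gt_eqF//; lra.
have d0 : 0 < a^-1 by rewrite invr_gt0; lra.
move: a^-1 ad d0 => d ad d0.
have LK : (a - b * q) * (a + b * (1 + q)) = 1.
  rewrite -[RHS]opprK -nab.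
  transitivity (a ^+ 2 + a * b - b ^+ 2 * (q ^+ 2 + q)); first by ring.
  by rewrite q2; ring.
have K0 : 17 / 5 * a <= a + b * (1 + q) by nra.
have K1 : a + b * (1 + q) <= 17 / 4 * a by nra.
move: (a + b * _) (a - b * _) LK K0 K1 => K L LK K0 K1.
have L0 : 0 < L by rewrite -(@pmulr_lgt0 _ K) ?LK//; lra.
have La : L = L * a * d by rewrite -mulrA ad mulr1.
have H0 : 23 / 100 <= L * a by nra.
have H1 : L * a <= 3 / 10 by nra.
by split=> //; [nra | apply/andP; split; rewrite La ler_pM2r].
Qed.

(** * Size, sign and growth of the perturbed sum *)

(** The constant terms cancel, and the quadratic part is (1 + q) v^2 / 2 - q u^2 / 2. As v is at
    least 3 u / 2, this exceeds u^2 with enough room for the terms of higher order. *)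
Lemma perturbed_pentagon_ge (R : realType) (s q u v : R) :
  9 / 10 <= s <= 1 -> 3 / 5 <= q <= 31 / 50 ->
  0 <= u -> 3 * u <= 2 * v -> v <= 1 / 10 ->
  u ^+ 2 - 2 * s * (u - q * v) <=
  1 + q * cos u - 2 * s * sin u - (1 + q) * cos v + 2 * q * s * sin v.
Proof.
move=> /andP[s0 s1] /andP[q0 q1] u0 uv v1.
have v0 : 0 <= v by lra.
have su := sin_le_id _ _ u0; have cu := cos_ge_taylor2 _ _ u0.
have sv := sin_ge_taylor3 _ _ v0; have cv := cos_le_taylor4 _ _ v0.
have u2 := sqr_ge0 u; have v2 := sqr_ge0 v.
have v4 : v ^+ 4 <= 1 / 100 * v ^+ 2.
  by rewrite (exprD v 2 2) ler_wpM2r// expr2; clear -v0 v1; nra.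
have v3 : v ^+ 3 <= 1 / 10 * v ^+ 2 by rewrite (exprS v 2) ler_wpM2r.
have uv2 : 9 / 4 * u ^+ 2 <= v ^+ 2 by clear -u0 uv; nra.
have cu0 : 0 <= 1 - cos u by rewrite subr_ge0 cos_le1.
have H1 : q * (1 - cos u) <= 31 / 50 * (1 - cos u) by rewrite ler_wpM2r.
have H2 : s * sin u <= s * u by rewrite ler_wpM2l//; lra.
have cv0 : 0 <= 1 - cos v by rewrite subr_ge0 cos_le1.
have H3 : 8 / 5 * (1 - cos v) <= (1 + q) * (1 - cos v) by rewrite ler_wpM2r//; lra.
have qs0 : 0 <= q * s by rewrite mulr_ge0//; lra.
have qs1 : q * s <= 31 / 50 * 1 by rewrite ler_pM//; lra.
have H4 : q * s * (v - v ^+ 3 / 6) <= q * s * sin v by rewrite ler_wpM2l.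
have H5 : q * s * v ^+ 3 <= 31 / 50 * 1 * (1 / 10 * v ^+ 2).
  by rewrite ler_pM// exprn_ge0.
lra.
Qed.

(** Here v <= 2 u bounds the quadratic part by 81/25 u^2, and the rest of 4 u^2 absorbs the cubic
    term of the sine. *)
Lemma perturbed_pentagon_le (R : realType) (s q u v : R) :
  9 / 10 <= s <= 1 -> 3 / 5 <= q <= 31 / 50 ->
  0 <= u <= 1 / 10 -> 0 <= v <= 2 * u ->
  1 + q * cos u - 2 * s * sin u - (1 + q) * cos v + 2 * q * s * sin v <=
  4 * u ^+ 2 - 2 * s * (u - q * v).
Proof.
move=> /andP[s0 s1] /andP[q0 q1] /andP[u0 u1] /andP[v0 uv].
have su := sin_ge_taylor3 _ _ u0; have cu := cos_le1 u.
have sv := sin_le_id _ _ v0; have cv := cos_ge_taylor2 _ _ v0.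
have u2 := sqr_ge0 u.
have u3 : u ^+ 3 <= 1 / 10 * u ^+ 2 by rewrite (exprS u 2) ler_wpM2r.
have uv2 : v ^+ 2 <= 4 * u ^+ 2 by clear -u0 v0 uv; nra.
have H1 : q * cos u <= q by rewrite ler_piMr//; lra.
have H2 : s * (u - u ^+ 3 / 6) <= s * sin u by rewrite ler_wpM2l//; lra.
have H2' : s * u ^+ 3 <= u ^+ 3 by rewrite ler_piMl// exprn_ge0.
have cv0 : 0 <= 1 - cos v by rewrite subr_ge0 cos_le1.
have H3 : (1 + q) * (1 - cos v) <= 81 / 50 * (1 - cos v) by rewrite ler_wpM2r//; lra.
have H4 : q * s * sin v <= q * s * v by rewrite ler_wpM2l// mulr_ge0//; lra.
lra.
Qed.

(** The quadratic term wins: a^2 t^2 is at least 4/5 t / a, while the linear loss is at most 3/5 t /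
    a. The upper bound on t only keeps b t below 1/10. *)
Lemma pentagon_sum_gt0 (R : realType) (a b t : R) : golden_pair R a b ->
  4 / 5 * a^-1 ^+ 3 <= t -> t <= 8 / 5 * a^-1 ^+ 3 ->
  0 < pentagon_sum R a b t.
Proof.
move=> gab; have [a10 lab uab _] := gab.
have [s [q [sb qb q2 ->]]] := pentagon_sumE R.
have := golden_pair_inv _ _ _ _ gab qb q2.
move: a^-1 => d [ad d0 d1 /andP[L0 L1]] t0 t1.
have a0 : 0 < a by lra.
have ak k : a * d ^+ k.+1 = d ^+ k by rewrite exprS mulrA ad mul1r.
have d3 : 0 < d ^+ 3 by rewrite exprn_gt0.
have t00 : 0 < t by lra.
have ut0 : 4 / 5 * d ^+ 2 <= a * t by rewrite -(ak 2) mulrCA ler_pM2l.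
have ut1 : a * t <= 8 / 5 * d ^+ 2 by rewrite -(ak 2) mulrCA ler_pM2l.
have d2 : d ^+ 2 <= 1 / 100 by clear -d0 d1; nra.
have vu : 3 * (a * t) <= 2 * (b * t) by rewrite !mulrA ler_pM2r.
have uv : b * t <= 2 * (a * t) by rewrite mulrA ler_pM2r.
have u0 : 0 <= a * t by rewrite mulr_ge0// ltW.
apply: lt_le_trans (perturbed_pentagon_ge _ _ _ _ _ sb qb u0 vu _); last by lra.
have -> : a * t - q * (b * t) = t * (a - b * q) by ring.
have tL0 : 0 <= t * (a - b * q) by apply: mulr_ge0; lra.
have sL : s * (t * (a - b * q)) <= t * (a - b * q).
  by rewrite ler_piMl//; case/andP: sb.
have tL : t * (a - b * q) <= t * (3 / 10 * d) by rewrite ler_pM2l.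
have au : a * (4 / 5 * d ^+ 2) <= a * (a * t) by rewrite ler_pM2l.
have := ak 1; rewrite expr1 => ak1.
have : t * (4 / 5 * d) <= t * (a * (a * t)) by rewrite ler_pM2l//; lra.
have : 0 < t * d by rewrite mulr_gt0.
lra.
Qed.

(** The linear term wins: 4 a^2 t^2 is at most 8/25 t / a, while the linear loss is at least 2 *
    9/10 * 23/100 t / a. *)
Lemma pentagon_sum_le0 (R : realType) (a b t : R) : golden_pair R a b ->
  0 <= t -> t <= 2 / 25 * a^-1 ^+ 3 ->
  pentagon_sum R a b t <= 0.
Proof.
move=> gab; have [a10 lab uab _] := gab.
have [s [q [sb qb q2 ->]]] := pentagon_sumE R.
have := golden_pair_inv _ _ _ _ gab qb q2.
move: a^-1 => d [ad d0 d1 /andP[L0 L1]] t0 t1.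
have a0 : 0 < a by lra.
have ak k : a * d ^+ k.+1 = d ^+ k by rewrite exprS mulrA ad mul1r.
have ut1 : a * t <= 2 / 25 * d ^+ 2 by rewrite -(ak 2) mulrCA ler_pM2l.
have d2 : d ^+ 2 <= 1 / 100 by clear -d0 d1; nra.
have uv : b * t <= 2 * (a * t) by rewrite mulrA ler_wpM2r.
have u0 : 0 <= a * t by rewrite mulr_ge0// ltW.
have ub : 0 <= a * t <= 1 / 10 by rewrite u0/=; lra.
have vb : 0 <= b * t <= 2 * (a * t) by rewrite uv mulr_ge0//; lra.
apply: le_trans (perturbed_pentagon_le _ _ _ _ _ sb qb ub vb) _.
have -> : a * t - q * (b * t) = t * (a - b * q) by ring.
have tL0 : 0 <= t * (a - b * q) by apply: mulr_ge0; lra.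
have sL : 9 / 10 * (t * (a - b * q)) <= s * (t * (a - b * q)).
  by rewrite ler_wpM2r//; case/andP: sb.
have tL : t * (23 / 100 * d) <= t * (a - b * q) by rewrite ler_wpM2l.
have au : a * (a * t) <= a * (2 / 25 * d ^+ 2) by rewrite ler_pM2l.
have := ak 1; rewrite expr1 => ak1.
have : t * (a * (a * t)) <= t * (2 / 25 * d) by rewrite ler_wpM2l//; lra.
have : 0 <= t * d by rewrite mulr_ge0// ltW.
lra.
Qed.

(** Mean value theorem: the derivative at 0 is - 2 s (a - b q) <= 0, and the remaining terms are of
    order a^2 t, hence of order 1 / a in this range of t. *)
Lemma pentagon_sum_increment_le (R : realType) (a b t t' : R) : golden_pair R a b ->
  0 <= t' -> t' <= t -> t <= 8 / 5 * a^-1 ^+ 3 ->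
  pentagon_sum R a b t - pentagon_sum R a b t' <= 16 * a^-1 * (t - t').
Proof.
move=> gab; have [a10 lab uab _] := gab.
have [s [q [/andP[s0 s1] qb q2 E]]] := pentagon_sumE R.
have := golden_pair_inv _ _ _ _ gab qb q2; move: a^-1 => d [ad d0 d1 /andP[L0 L1]].
move: qb => /andP[q0 q1].
have ak k : a * d ^+ k.+1 = d ^+ k by rewrite exprS mulrA ad mul1r.
move=> t'0 tt t1.
pose f t : R :=  1 + q * cos (a * t) - 2 * s * sin (a * t)
        - (1 + q) * cos (b * t) + 2 * q * s * sin (b * t).
pose df t : R := - a * q * sin (a * t) - 2 * a * s * cos (a * t)
        + b * (1 + q) * sin (b * t) + 2 * b * q * s * cos (b * t).
have fdf (x : R) : is_derive x 1 f (df x).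
  by rewrite /f /df; apply: is_derive_eq; rewrite /GRing.scale/=; ring.
have fc : {within `[t', t], continuous f}.
  apply: continuous_subspaceT => y; apply: differentiable_continuous.
  by apply/derivable1_diffP; exact: ex_derive.
have [x] := MVT_segment tt (fun y _ => fdf y) fc.
rewrite in_itv/= => /andP[x0 x1]; rewrite !E -/(f t) -/(f t') => ->.
apply: ler_wpM2r; first by rewrite subr_ge0.
rewrite /df.
have {}x0 : 0 <= x by lra.
have {}x1 : x <= 8 / 5 * d ^+ 3 by lra.
have a0 : 0 < a by lra.
have ut1 : a * x <= 8 / 5 * d ^+ 2 by rewrite -(ak 2) mulrCA ler_pM2l.
have d2 : d ^+ 2 <= 1 / 100 by clear -d0 d1; nra.
have u0 : 0 <= a * x by rewrite mulr_ge0// ltW.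
have v0 : 0 <= b * x by rewrite mulr_ge0//; lra.
have uv : b * x <= 2 * (a * x) by rewrite mulrA ler_wpM2r.
have au : a * (a * x) <= 8 / 5 * d.
  have : a * (a * x) <= a * (8 / 5 * d ^+ 2) by rewrite ler_pM2l.
  by have := ak 1; rewrite expr1; lra.
move: (a * x) (b * x) ut1 u0 v0 uv au => u v ut1 u0 v0 uv au.
have su : 0 <= sin u by apply: sin_ge0_pi; have := pi_ge2 R; rewrite u0/=; lra.
have cu := cos_ge_taylor2 _ _ u0.
have sv := sin_le_id _ _ v0; have cv := cos_le1 v.
have H1 : 0 <= a * q * sin u by rewrite !mulr_ge0// ?ltW//; lra.
have as0 : 0 <= a * s by rewrite mulr_ge0//; lra.
have H2 : a * s * (1 - u ^+ 2 / 2) <= a * s * cos u by rewrite ler_wpM2l.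
have au0 : 0 <= a * u by rewrite mulr_ge0// ltW.
have auu : a * u * u <= 8 / 5 * d * 1 by apply: ler_pM => //; lra.
have H2' : s * (a * u * u) <= 1 * (8 / 5 * d * 1).
  by apply: ler_pM => //; [lra | rewrite mulr_ge0].
have b0 : 0 <= b by lra.
have bv : b * v <= 2 * a * (2 * u) by rewrite ler_pM.
have H3 : (1 + q) * (b * sin v) <= 81 / 50 * (b * v).
  apply: le_trans (_ : (1 + q) * (b * v) <= _).
    by rewrite !ler_wpM2l//; lra.
  by rewrite ler_wpM2r ?mulr_ge0//; lra.
have H4 : b * q * s * cos v <= b * q * s by rewrite ler_piMr// !mulr_ge0//; lra.
have H5 : 0 <= s * (a - b * q) by rewrite mulr_ge0//; lra.
lra.
Qed.

(** * Fibonacci pairs and the choice of n *)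

Lemma golden_pair_exists (R : realType) (N : nat) : exists a b : nat,
  [/\ (N <= a)%N, (b <= 2 * a)%N & golden_pair R a%:R b%:R].
Proof.
have [a [b [Na ab ba ab1]]] : exists a b : nat, [/\ (N + 10 <= a)%N,
    (3 * a <= 2 * b)%N, (b <= 2 * a)%N & (b ^ 2 + 1 = a * b + a ^ 2)%N].
  (* Both entries are Fibonacci numbers. One Fibonacci step flips the sign of b^2 - a b - a^2, so
     the induction advances by two. *)
  elim: N => [|N [a [b [Na ab ba ab1]]]]; first by exists 13, 21.
  by exists (a + b)%N, (a + 2 * b)%N; split; lia.
exists a, b; split=> //; first by lia.
split.
- by rewrite ler_nat; lia.
- by rewrite -!natrM ler_nat.
- by rewrite -natrM ler_nat.
- have /(congr1 (fun n => n%:R : R)) := ab1; rewrite !natrD !natrM.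
  lra.
Qed.

(** With n = 5 m and t = 2 pi / n, the two angles are 2 pi (m + a) / n and 2 pi (2 m - b) / n;
    [b <= 2 * m] keeps the subtraction of naturals exact. *)
Lemma pentagon_sum_root_sum_min (R : realType) (a b m : nat) :
    (0 < m)%N -> (b <= 2 * m)%N ->
    let S := pentagon_sum R a%:R b%:R (2 * pi / (5 * m%:R)) in
  0 < S -> root_sum_min R 5 (5 * m) <= S.
Proof.
move=> m0 bm; apply: (@root_sum_min5_le R (5 * m) (m + a) (2 * m - b)).
- by rewrite natrM natrD; field; rewrite pnatr_eq0 -lt0n.
- by rewrite natrB// !natrM; field; rewrite pnatr_eq0 -lt0n.
Qed.

Lemma root_sum_min_golden (R : realType) (a b : nat) :
    (b <= 2 * a)%N -> golden_pair R a%:R b%:R ->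
  exists m : nat, [/\ (a <= m)%N, (5 * m <= 100 * a ^ 3)%N &
    root_sum_min R 5 (5 * m) <= 64 * a%:R^-1 ^+ 7].
Proof.
move=> ba gab; have [a10 _ _ _] := gab.
have a0 : (0 < a)%N by rewrite -(ltr_nat R); lra.
have p2 := pi_ge2 R; have p4 := pihalf_lt2 R.
pose t (m : nat) : R := 2 * pi / (5 * m%:R).
pose P m := (a ^ 3 <= m)%N && (pentagon_sum R a%:R b%:R (t m) <= 0).
have tE k : (0 < k)%N -> t (k * a ^ 3)%N = 2 * pi / (5 * k%:R) * a%:R^-1 ^+ 3.
  move=> k0; rewrite /t natrM natrX; field.
  by rewrite !pnatr_eq0 -!lt0n a0.
have d3 : 0 < (a%:R : R)^-1 ^+ 3 by rewrite exprn_gt0// invr_gt0 ltr0n.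
(* The factor 20 gives t = pi / 50 * a^-3, which is at most 2/25 a^-3 because pi < 4. *)
have P20 : P (20 * a ^ 3)%N.
  rewrite /P leq_pmull//=; have t20 := tE 20 isT.
  apply: pentagon_sum_le0 => //; rewrite t20; first by apply: mulr_ge0; lra.
  by rewrite ler_pM2r//; lra.
case: (ex_minnP (ex_intro P _ P20)) => M /andP[aM SM] Mmin.
have M20 := Mmin _ P20.
have t1 : t (a ^ 3)%N = 2 * pi / 5 * a%:R^-1 ^+ 3.
  by have := tE 1 isT; rewrite mul1n mulr1.
(* From 2 <= pi < 4, the factor 2 pi / 5 lies between 4/5 and 8/5. So the minimal [M] is not a^3,
   and its predecessor [m] still satisfies a^3 <= m. *)
have S1 : 0 < pentagon_sum R a%:R b%:R (t (a ^ 3)%N).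
  by apply: pentagon_sum_gt0 => //; rewrite t1 ler_pM2r//; lra.
have {aM} aM : (a ^ 3 < M)%N.
  by rewrite ltn_neqAle aM andbT; apply: contraTneq SM => <-; rewrite -ltNge.
case: M aM => [//|m] aM in SM Mmin M20 *; rewrite ltnS in aM.
have m0 : (0 < m)%N by rewrite (leq_trans _ aM)// expn_gt0 a0.
have Sm : 0 < pentagon_sum R a%:R b%:R (t m).
  by rewrite ltNge; apply/negP => Sm; have := Mmin m; rewrite /P aM Sm ltnn => /(_ isT).
have am : (a <= m)%N by rewrite (leq_trans _ aM)// -{1}(expn1 a) leq_pexp2l.
exists m; split=> //; first by lia.
apply: le_trans (pentagon_sum_root_sum_min R a b m m0 _ Sm) _; first by lia.
have m0R : 0 < m%:R :> R by rewrite ltr0n.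
have tS : t m - t m.+1 = 2 * pi / (5 * (m%:R * m.+1%:R)).
  rewrite /t -natr1; field.
  by rewrite addrC natr1 !pnatr_eq0 -!lt0n m0.
have amR : a%:R ^+ 3 <= m%:R :> R by rewrite -natrX ler_nat.
have mV : (m%:R)^-1 <= a%:R^-1 ^+ 3 :> R.
  by rewrite exprVn lef_pV2 ?posrE ?exprn_gt0 ?ltr0n//.
have tm1 : t m <= t (a ^ 3)%N.
  rewrite t1 /t invfM mulrA ler_wpM2l//; lra.
have tmS : 0 <= t m - t m.+1 <= 8 / 5 * a%:R^-1 ^+ 6.
  rewrite tS; apply/andP; split.
    by apply: divr_ge0; [lra | rewrite !mulr_ge0].
  rewrite invfM mulrA; apply: ler_pM; [lra| |lra|].
    by rewrite invr_ge0 mulr_ge0.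
  rewrite (exprD _ 3 3) invfM; apply: ler_pM => //.
  by apply: le_trans mV; rewrite lef_pV2 ?posrE// ler_nat.
case/andP: tmS => tmS tmS'.
have tS0 : 0 <= t m.+1 by rewrite /t divr_ge0 ?mulr_ge0//; lra.
(* The sum is at most 0 at [t m.+1], so its value at [t m] is at most the increment, which is
   bounded by 16 / a * 8/5 a^-6 <= 64 a^-7. *)
have := pentagon_sum_increment_le R a%:R b%:R (t m) (t m.+1) gab tS0.
rewrite -subr_ge0 tmS => /(_ isT); rewrite (le_trans tm1); last first.
  by rewrite t1 ler_pM2r//; lra.
move=> /(_ isT) H.
have d0 : 0 < (a%:R : R)^-1 by rewrite invr_gt0 ltr0n.
have : 16 * a%:R^-1 * (t m - t m.+1) <= 16 * a%:R^-1 * (8 / 5 * a%:R^-1 ^+ 6).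
  by rewrite ler_pM2l//; lra.
rewrite (exprS _ 6); have d7 : 0 <= (a%:R : R)^-1 * a%:R^-1 ^+ 6.
  by rewrite mulr_ge0// ?exprn_ge0 ltW.
lra.
Qed.

(** * From powers of a to powers of n, and infinitely many n *)

Lemma powR_seven_thirds (R : realType) (x y : R) : 0 < x -> 0 < y -> y <= 100 * x ^+ 3 ->
  x^-1 ^+ 7 <= 100 `^ (7 / 3) * y `^ (- (7 / 3)).
Proof.
move=> x0 y0 yx.
have p0 : 0 < y `^ (7 / 3) by rewrite powR_gt0.
rewrite powRN exprVn ler_pdivlMr// mulrC ler_pdivrMr ?exprn_gt0//.
have -> : x ^+ 7 = (x ^+ 3) `^ (7 / 3).
  rewrite -!powR_mulrn ?ltW// -powRrM; congr (_ `^ _); lra.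
rewrite -powRM ?exprn_ge0//; last exact: ltW.
have x3 : 0 <= 100 * x ^+ 3 by rewrite mulr_ge0// exprn_ge0// ltW.
by apply: ge0_ler_powR; rewrite ?nnegrE//; lra.
Qed.

Theorem theorem1p2 (R : realType) :
  exists C : R, 0 < C /\
    infinite_set [set n : nat | (0 < n)%N /\
      root_sum_min R 5 n <= C * n%:R `^ (- (7 / 3))].
Proof.
exists (64 * 100 `^ (7 / 3)); split; first by rewrite mulr_gt0// powR_gt0.
(* If the set were finite it would have a maximum [N]; a pair with a > N gives n = 5 m >= 5 a > N in
   the set. *)
move=> /finite_seqP[s sE]; pose N := \max_(i <- s) i.
suff [n [Nn An]] : exists n : nat, (N < n)%N /\ [set n : nat | (0 < n)%N /\
    root_sum_min R 5 n <= 64 * 100 `^ (7 / 3) * n%:R `^ (- (7 / 3))] n.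
  move: An; rewrite sE /= => ns.
  by move: Nn; rewrite ltnNge /N (@leq_bigmax_seq _ s xpredT id n).
have [a [b [Na ba gab]]] := golden_pair_exists R N.+1.
have [m [am m100 mle]] := root_sum_min_golden R a b ba gab.
exists (5 * m)%N; split; first by lia.
split; first by lia.
apply: le_trans mle _.
rewrite -mulrA ler_pM2l//; apply: powR_seven_thirds; rewrite ?ltr0n; [lia | lia |].
by rewrite -natrX -natrM ler_nat.
Qed.
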